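(* Let $f:\mathbb{R}^p\to\mathbb{R}\cup\{+\infty\}$ and $g:\mathbb{R}^n\to\mathbb{R}\cup\{+\infty\}$ be proper, closed and convex, let $K:\mathbb{R}^p\to\mathbb{R}^n$ be linear, assume that the solution set of the primal problem $F^\star=\min_{x}\{F(x):=f(x)+g(Kx)\}$ is nonempty and that $0\in\mathrm{ri}(\mathrm{dom}(g)-K\,\mathrm{dom}(f))$. Let $x^\star$ be an optimal solution of the primal problem and $y^\star$ an optimal solution of the dual problem $\min_y\{f^*(-K^\top y)+g^*(y)\}$. Let $\rho_0>0$, $\gamma\in(0,1)$, and let $\{x^k\}$ be generated by Algorithm 1 (defined in the context) with $c>1$. Then for all $k\ge0$, $$0\le\widetilde{\mathcal{L}}(x^k,y^\star)-F^\star\le\frac{R_0^2}{k+c-1}\qquad\text{and}\qquad\liminf_{k\to\infty}\;k\log(k)\left[\widetilde{\mathcal{L}}(x^k,y^\star)-F^\star\right]=0,$$ where $$R_0^2:=(c-1)[F(x^0)-F^\star]+\frac c2\left[\frac{\rho_0\|K\|^2}{\gamma}\|x^0-x^\star\|^2+\frac{1}{(1-\gamma)\rho_0}\|y^0-y^\star\|^2\right].$$ Moreover, if $g$ is $M_g$-Lipschitz continuous on $\mathrm{dom}(g)$, then for all $k\ge0$, $$0\le F(x^k)-F^\star\le\frac{R_1^2}{k+c-1}\qquad\text{and}\qquad\liminf_{k\to\infty}\;k\sqrt{\log k}\,[F(x^k)-F^\star]=0,$$ where $R_1^2:=R_0^2+\sqrt{2c/\rho_0}\,(\|y^\star\|+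M_g)R_0$.
   Context: $f^*,g^*$ are Fenchel conjugates; $\mathrm{ri}$ is the relative interior; $\|K\|$ is the operator norm; $\mathrm{prox}_h(x):=\arg\min_y\{h(y)+\frac12\|y-x\|^2\}$. A function $h$ is $M$-Lipschitz continuous on $\mathrm{dom}(h)=\{x: h(x)<+\infty\}$, with $M\in[0,+\infty)$, if $|h(x)-h(y)|\le M\|x-y\|$ for all $x,y\in\mathrm{dom}(h)$. Lagrange function: $\widetilde{\mathcal{L}}(x,y):=f(x)+\langle Kx,y\rangle-g^*(y)$. Algorithm 1. Inputs: $x^0\in\mathbb{R}^p$, $y^0\in\mathbb{R}^n$, $\rho_0>0$, $c\ge1$, $\gamma\in(0,1)$. Set $\tau_0:=1$, $x^{-1}:=\hat x^0:=x^0$, $\tilde y^{-1}:=\tilde y^0:=\bar y^0:=y^0$. For $k=0,1,2,\dots$: 1. $\rho_k:=\frac{\rho_0}{\tau_k}$, $\beta_k:=\frac{\gamma}{\|K\|^2\rho_k}$, $\eta_k:=(1-\gamma)\rho_k$, $\tau_{k+1}:=\frac{c}{k+c+1}$ (so $\tau_k=\frac{c}{k+c}$ for all $k\ge0$). 2. $y^{k+1}:=\mathrm{prox}_{\rho_kg^*}(\tilde y^k+\rho_kK\hat x^k)$; $x^{k+1}:=\mathrm{prox}_{\beta_kf}(\hat x^k-\beta_kK^\top y^{k+1})$; $\hat x^{k+1}:=x^{k+1}+\frac{\tau_{k+1}(1-\tau_k)}{\tau_k}(x^{k+1}-x^k)$. 3. $\tilde y^{k+1}:=\tilde y^k+\eta_kK[x^{k+1}-\hat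 x^k-(1-\tau_k)(x^k-\hat x^{k-1})]+(1-\gamma)\left[y^{k+1}-\tilde y^k-\frac{\tau_{k-1}(1-\tau_k)}{\tau_k}(y^k-\tilde y^{k-1})\right]$. 4. $\bar y^{k+1}:=(1-\tau_k)\bar y^k+\tau_ky^{k+1}$. At $k=0$ the terms in step 3 multiplied by $1-\tau_0=0$ vanish.
   Formalization: In the ''moreover'' part it is additionally assumed that Kx^k lies in dom(g) for all k ≥ 1 (otherwise F(x^k) can be +∞ while R_1 is finite, e.g. g the indicator of a point); K ≠ 0 is assumed so that β_k is defined. *)

(* Defs.v *)
From HB Require Import structures.
From mathcomp Require Import all_boot all_order all_algebra.
From mathcomp Require Import all_classical all_reals all_analysis.

Set Implicit Arguments.
Unset Strict Implicit.
Unset Printing Implicit Defensive.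

Import Order.TTheory GRing.Theory Num.Theory.
Import numFieldNormedType.Exports.

Local Open Scope classical_set_scope.
Local Open Scope ring_scope.

Section Euclidean.
Context {R : realType}.

Definition dot {d : nat} (x y : 'cV[R]_d) : R := \sum_i x i 0 * y i 0.

(* The norm `|x| that the library puts on matrices is the sup norm, hence a
   separate Euclidean norm; both induce the same topology. *)
Definition enorm {d : nat} (x : 'cV[R]_d) : R := Num.sqrt (dot x x).

Definition opnorm {p n : nat} (K : 'M[R]_(n, p)) : R :=
  sup [set enorm (K *m x) | x in [set x : 'cV[R]_p | enorm x <= 1]].

Definition affine_hull {d : nat} (C : set 'cV[R]_d) : set 'cV[R]_d :=
  [set x | exists (m : nat) (v : 'I_m -> 'cV[R]_d) (l : 'I_m -> R),
    [/\ forall i, C (v i), \sum_i l i = 1 & x = \sum_i l i *: v i]].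

Definition rel_interior {d : nat} (C : set 'cV[R]_d) : set 'cV[R]_d :=
  [set x | affine_hull C x /\ exists2 e : R, 0 < e &
    forall y, affine_hull C y -> enorm (y - x) < e -> C y].

End Euclidean.

Local Open Scope ereal_scope.

(* Functions into R U {+oo} are functions into \bar R that avoid -oo; that
   condition is part of [proper_fun]. *)
Section ConvexAnalysis.
Context {R : realType} {d : nat}.
Implicit Types (h : 'cV[R]_d -> \bar R).

Definition dom h : set 'cV[R]_d := [set x | h x < +oo].

Definition proper_fun h : Prop := (forall x, h x != -oo) /\ dom h !=set0.

Definition epigraph h : set ('cV[R]_d * R) := [set z | h z.1 <= z.2%:E].

Definition closed_fun h : Prop := closed (epigraph h).

(* As 0 * +oo = 0 in \bar R, the endpoints t = 0 and t = 1 are harmless. *)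
Definition convex_fun h : Prop :=
  forall (x y : 'cV[R]_d) (t : R), (0 <= t <= 1)%R ->
    h (t *: x + (1 - t) *: y)%R <= t%:E * h x + (1 - t)%:E * h y.

Definition proper_closed_convex h : Prop :=
  [/\ proper_fun h, closed_fun h & convex_fun h].

Definition conjugate h : 'cV[R]_d -> \bar R :=
  fun y => ereal_sup [set (dot x y)%:E - h x | x in [set: 'cV[R]_d]].

Definition argmin h : set 'cV[R]_d := [set x | forall y, h x <= h y].

(* The set of minimizers; it is a singleton when h is proper closed convex. *)
Definition prox h (x : 'cV[R]_d) : set 'cV[R]_d :=
  argmin (fun y => h y + (2^-1 * enorm (y - x) ^+ 2)%:E).

Definition lipschitz_on_dom (M : R) h : Prop :=
  forall x y, dom h x -> dom h y -> `|h x - h y| <= (M * enorm (x - y))%:E.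

End ConvexAnalysis.

Section Problem.
Context {R : realType} {p n : nat}.
Variables (f : 'cV[R]_p -> \bar R) (g : 'cV[R]_n -> \bar R) (K : 'M[R]_(n, p)).

Definition primal (x : 'cV[R]_p) : \bar R := f x + g (K *m x)%R.

Definition primal_val : \bar R := ereal_inf (range primal).

Definition dual (y : 'cV[R]_n) : \bar R :=
  conjugate f (- (K^T *m y))%R + conjugate g y.

Definition lagrangian (x : 'cV[R]_p) (y : 'cV[R]_n) : \bar R :=
  f x + (dot (K *m x)%R y)%:E - conjugate g y.

Definition dom_diff : set 'cV[R]_n :=
  [set (u - K *m x)%R | u in dom g & x in dom f].

End Problem.

Local Open Scope ring_scope.

Section Algorithm.
Context {R : realType} {p n : nat}.

Definition tau (c : R) (k : nat) : R :=
  if k is j.+1 then c / (j%:R + c + 1) else 1.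

Definition rho (rho0 c : R) (k : nat) : R := rho0 / tau c k.

Definition beta (K : 'M[R]_(n, p)) (rho0 c gamma : R) (k : nat) : R :=
  gamma / (opnorm K ^+ 2 * rho rho0 c k).

Definition eta (rho0 c gamma : R) (k : nat) : R := (1 - gamma) * rho rho0 c k.

(* An index k - 1 is written k.-1: for k = 0 the terms indexed by -1 are
   multiplied by 1 - tau c 0 = 0, so the value chosen for them is irrelevant. *)
Record pd_iterates (f : 'cV[R]_p -> \bar R) (g : 'cV[R]_n -> \bar R)
    (K : 'M[R]_(n, p)) (rho0 c gamma : R) (x0 : 'cV[R]_p) (y0 : 'cV[R]_n)
    (x xhat : nat -> 'cV[R]_p) (y ytilde ybar : nat -> 'cV[R]_n) : Prop :=
  PdIterates {
  pd_x0 : x 0%N = x0;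
  pd_xhat0 : xhat 0%N = x0;
  pd_y0 : y 0%N = y0;
  pd_ytilde0 : ytilde 0%N = y0;
  pd_ybar0 : ybar 0%N = y0;
  pd_y : forall k,
    prox (fun u => (rho rho0 c k)%:E * conjugate g u)%E
      (ytilde k + rho rho0 c k *: (K *m xhat k)) (y k.+1);
  pd_x : forall k,
    prox (fun u => (beta K rho0 c gamma k)%:E * f u)%E
      (xhat k - beta K rho0 c gamma k *: (K^T *m y k.+1)) (x k.+1);
  pd_xhat : forall k,
    xhat k.+1 = x k.+1
      + (tau c k.+1 * (1 - tau c k) / tau c k) *: (x k.+1 - x k);
  pd_ytilde : forall k,
    ytilde k.+1 = ytilde k
      + eta rho0 c gamma k *:
          (K *m (x k.+1 - xhat k - (1 - tau c k) *: (x k - xhat k.-1)))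
      + (1 - gamma) *:
          (y k.+1 - ytilde k
           - (tau c k.-1 * (1 - tau c k) / tau c k) *: (y k - ytilde k.-1));
  pd_ybar : forall k,
    ybar k.+1 = (1 - tau c k) *: ybar k + tau c k *: y k.+1
}.

End Algorithm.

Section Constants.
Context {R : realType} {p n : nat}.
Variables (f : 'cV[R]_p -> \bar R) (g : 'cV[R]_n -> \bar R) (K : 'M[R]_(n, p)).
Variables (rho0 c gamma : R) (x0 xs : 'cV[R]_p) (y0 ys : 'cV[R]_n).

(* R0sq and R1sq are +oo when F(x0) = +oo, as x0 need not lie in dom F. *)
Definition R0sq : \bar R :=
  ((c - 1)%:E * (primal f g K x0 - primal_val f g K)
   + (c / 2 * (rho0 * opnorm K ^+ 2 / gamma * enorm (x0 - xs) ^+ 2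
               + ((1 - gamma) * rho0)^-1 * enorm (y0 - ys) ^+ 2))%:E)%E.

Definition R1sq (Mg : R) : \bar R :=
  (R0sq + (Num.sqrt (2 * c / rho0) * (enorm ys + Mg))%:E * sqrte R0sq)%E.

End Constants.

(* Main.v *)
Require Import Defs.
From HB Require Import structures.
From mathcomp Require Import all_boot all_order all_algebra.
From mathcomp Require Import all_classical all_reals all_analysis.
From mathcomp Require Import ring lra.

Set Implicit Arguments.
Unset Strict Implicit.
Unset Printing Implicit Defensive.

Import Order.TTheory GRing.Theory Num.Theory.
Import numFieldNormedType.Exports.

Local Open Scope classical_set_scope.
Local Open Scope ring_scope.

(** Write [F*] for the optimal value. The proof has three ingredients.

    Duality. The qualification condition says that 0 is in the relative interior
    of the domain of the perturbation function u |-> inf_x f x + g (K x + u), so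
    this convex function has a subgradient at 0 ([convex_majorant]). Hence the
    dual value is [- F*] ([dual_attained]) and the Lagrangian at a dual optimum
    is bounded below by [F*] ([dual_opt_saddle]). This gives the lower bounds.

    Descent. The algorithm is an accelerated, linearized augmented Lagrangian
    method for min f x + g r subject to K x = r. The point
    r^(k+1) = K xhat^k + (ytilde^k - y^(k+1)) / rho_k is a subgradient of the
    conjugate of g at y^(k+1). Put u^k = K x^k - r^k and
    S_k = f x^k + g r^k + <ys, u^k> - F*. Adding the subgradient inequalities of
    the two proximal steps, with weights 1 - tau_k at the previous iterate and
    tau_k at the solution, and completing squares yields
    (k + c) S_(k+1) + q (k + c)^2 |u^(k+1)|^2 + A_(k+1)
      <= k S_k + q k^2 |u^k|^2 + A_k   with q = rho0 / (2 c),
    where A_k is a weighted sum of squared distances to the two solutions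
    ([pd_one_step], [pd_descent]). As c > 1, the coefficients on the right at
    k + 1 are smaller than those on the left at k, so telescoping gives both
    the rates S_k <= A_0 / (k + c - 1), |u^k|^2 <= A_0 / (q (k + c - 1)^2) and the
    convergence of the series of S_k + k |u^k|^2 ([descent_rates]).

    Conclusion. The Lagrangian gap is at most S_k, by the Fenchel inequality.
    If g is Lipschitz on its domain, replacing g r^k by g (K x^k) costs at most
    M_g |u^k|, so F x^k - F* <= S_k + (|ys| + M_g) |u^k|; here
    [fenchel_equality_of_conjugate] identifies g r^k with <r^k, y^k> minus the
    conjugate of g at y^k. The two lower limits follow from the convergent
    series, because the series of 1 / (k ln k) diverges
    ([summable_log_small], [summable_sqrt_log_small]). *)

(** * Euclidean inner product and operator norm *)

Lemma dotC (R : realType) d (x y : 'cV[R]_d) : dot x y = dot y x.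
Proof. by apply: eq_bigr => i _; rewrite mulrC. Qed.

Lemma dotDl (R : realType) d (x y z : 'cV[R]_d) :
  dot (x + y) z = dot x z + dot y z.
Proof. by rewrite /dot -big_split; apply: eq_bigr => i _; rewrite mxE mulrDl. Qed.

Lemma dotZl (R : realType) d (a : R) (x y : 'cV[R]_d) :
  dot (a *: x) y = a * dot x y.
Proof. by rewrite /dot mulr_sumr; apply: eq_bigr => i _; rewrite mxE mulrA. Qed.

Lemma dotNl (R : realType) d (x y : 'cV[R]_d) : dot (- x) y = - dot x y.
Proof. by rewrite -scaleN1r dotZl mulN1r. Qed.

Lemma dotDr (R : realType) d (x y z : 'cV[R]_d) :
  dot x (y + z) = dot x y + dot x z.
Proof. by rewrite dotC dotDl !(dotC x). Qed.

Lemma dotZr (R : realType) d (a : R) (x y : 'cV[R]_d) :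
  dot x (a *: y) = a * dot x y.
Proof. by rewrite dotC dotZl (dotC x). Qed.

Lemma dotNr (R : realType) d (x y : 'cV[R]_d) : dot x (- y) = - dot x y.
Proof. by rewrite dotC dotNl (dotC x). Qed.

Lemma dot0l (R : realType) d (x : 'cV[R]_d) : dot 0 x = 0.
Proof. by rewrite -(scale0r x) dotZl mul0r. Qed.

Definition dotE := (@dotDl, @dotDr, @dotNl, @dotNr, @dotZl, @dotZr).

Lemma dot_adjoint (R : realType) p n (K : 'M[R]_(n, p)) x y :
  dot (K *m x) y = dot x (K^T *m y).
Proof.
rewrite /dot.
under eq_bigr => i _ do rewrite mxE mulr_suml.
rewrite exchange_big /=; apply: eq_bigr => j _.
rewrite mxE mulr_sumr; apply: eq_bigr => i _.
by rewrite mxE mulrCA mulrA.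
Qed.

Lemma dot_ge0 (R : realType) d (x : 'cV[R]_d) : 0 <= dot x x.
Proof. by apply: sumr_ge0 => i _; rewrite -expr2 sqr_ge0. Qed.

Lemma dot_coord (R : realType) d (x : 'cV[R]_d) i : x i 0 ^+ 2 <= dot x x.
Proof.
rewrite /dot (bigD1 i) //= expr2 lerDl.
by apply: sumr_ge0 => j _; rewrite -expr2 sqr_ge0.
Qed.

Lemma dot_eq0 (R : realType) d (x : 'cV[R]_d) : dot x x <= 0 -> x = 0.
Proof.
move=> x0; apply/colP => i; rewrite mxE; apply/eqP; rewrite -sqrf_eq0.
by rewrite eq_le sqr_ge0 (le_trans (dot_coord _ _)).
Qed.

Lemma enorm_sqr (R : realType) d (x : 'cV[R]_d) : enorm x ^+ 2 = dot x x.
Proof. by rewrite sqr_sqrtr ?dot_ge0. Qed.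

Lemma enorm_ge0 (R : realType) d (x : 'cV[R]_d) : 0 <= enorm x.
Proof. exact: sqrtr_ge0. Qed.

Lemma enormZ (R : realType) d (a : R) (x : 'cV[R]_d) :
  enorm (a *: x) = `|a| * enorm x.
Proof.
by rewrite /enorm !dotE mulrA -expr2 sqrtrM ?sqr_ge0// sqrtr_sqr.
Qed.

(** Expanding the square of [|x|^2 y - <x,y> x] avoids a square root. *)
Lemma cauchy_schwarz_sqr (R : realType) d (x y : 'cV[R]_d) :
  dot x y ^+ 2 <= dot x x * dot y y.
Proof.
have := dot_ge0 (dot x x *: y - dot x y *: x).
rewrite !dotE (dotC y x).
set a := dot x x; set b := dot x y; set e := dot y y => H.
have a_ge0 : 0 <= a := dot_ge0 x.
have [a_gt0|a_le0] := ltP 0 a.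
  rewrite -subr_ge0 -(pmulr_rge0 _ a_gt0); move: H; congr (0 <= _); ring.
by rewrite /b /a (dot_eq0 a_le0) !dot0l mul0r expr0n.
Qed.

Lemma cauchy_schwarz (R : realType) d (x y : 'cV[R]_d) :
  `|dot x y| <= enorm x * enorm y.
Proof.
rewrite -sqrtr_sqr -sqrtrM ?dot_ge0//.
exact/ler_wsqrtr/cauchy_schwarz_sqr.
Qed.

(** The Frobenius norm bounds [K], by Cauchy-Schwarz on each row. It makes the
    supremum in [opnorm K] one of a bounded set. *)
Lemma mulmx_bounded (R : realType) p n (K : 'M[R]_(n, p)) :
  exists2 B : R, 0 <= B & forall x, enorm (K *m x) <= B * enorm x.
Proof.
pose F := \sum_i dot (row i K)^T (row i K)^T.
have F0 : 0 <= F by apply: sumr_ge0 => i _; exact: dot_ge0.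
exists (Num.sqrt F); rewrite ?sqrtr_ge0// => x.
rewrite -sqrtrM//; apply: ler_wsqrtr.
rewrite /F mulr_suml; apply: ler_sum => i _.
have -> : (K *m x) i 0 = dot (row i K)^T x.
  by rewrite mxE; apply: eq_bigr => j _; rewrite !mxE.
by rewrite -expr2 cauchy_schwarz_sqr.
Qed.

Lemma enorm0 (R : realType) d : enorm (0 : 'cV[R]_d) = 0.
Proof. by rewrite /enorm dot0l sqrtr0. Qed.

Lemma enorm_eq0 (R : realType) d (x : 'cV[R]_d) : enorm x = 0 -> x = 0.
Proof. by move=> x0; apply: dot_eq0; rewrite -enorm_sqr x0 expr0n. Qed.

Lemma opnorm_le (R : realType) p n (K : 'M[R]_(n, p)) x :
  enorm (K *m x) <= opnorm K * enorm x.
Proof.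
have [B B0 KB] := mulmx_bounded K.
have supK : has_sup [set enorm (K *m x) | x in [set x : 'cV[R]_p | enorm x <= 1]].
  split; first by exists (enorm (K *m 0)), 0 => //=; rewrite enorm0.
  exists B => _ [z /= z1 <-]; apply: le_trans (KB z) _.
  by rewrite -[leRHS]mulr1 ler_wpM2l.
have [x0|x0] := eqVneq (enorm x) 0.
  by rewrite (enorm_eq0 x0) mulmx0 !enorm0 mulr0.
have x_gt0 : 0 < enorm x by rewrite lt0r x0 enorm_ge0.
have /(ub_le_sup supK.2) :
    [set enorm (K *m x) | x in [set x : 'cV[R]_p | enorm x <= 1]]
      (enorm (K *m ((enorm x)^-1 *: x))).
  exists ((enorm x)^-1 *: x) => //=.
  by rewrite enormZ ger0_norm ?invr_ge0 ?enorm_ge0// mulVf.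
rewrite -scalemxAr enormZ ger0_norm ?invr_ge0 ?enorm_ge0//.
by rewrite mulrC ler_pdivrMr.
Qed.

Lemma opnorm_gt0 (R : realType) p n (K : 'M[R]_(n, p)) :
  K != 0 -> 0 < opnorm K.
Proof.
move=> K0; rewrite ltNge; apply/negP => oK.
case/negP: K0; apply/eqP/matrixP => i j; rewrite mxE.
have : K *m delta_mx j 0 = 0 :> 'cV_n.
  apply: enorm_eq0; apply/eqP; rewrite eq_le enorm_ge0 andbT.
  by apply: le_trans (opnorm_le K _) _; rewrite mulr_le0_ge0 ?enorm_ge0.
by rewrite -colE => /colP/(_ i); rewrite !mxE.
Qed.

(** * Subgradients, proximal points and conjugates *)

(** Finiteness of [h u] is part of the notion, as [fine] is applied to it. *)
Definition subgradient (R : realType) d (h : 'cV[R]_d -> \bar R) (u v : 'cV[R]_d) :=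
  h u \is a fin_num /\
  forall z, ((fine (h u) + dot v (z - u))%:E <= h z)%E.

Lemma scaled_bound_le0 (R : realType) (a b : R) :
  (forall t, 0 < t <= 1 -> a <= t * b) -> a <= 0.
Proof.
move=> H; rewrite leNgt; apply/negP => a0.
pose t := a / (a + `|b| + 1 ).
have b0 := normr_ge0 b.
have t0 : 0 < t by rewrite divr_gt0//; lra.
have t1 : t <= 1 by rewrite ler_pdivrMr; lra.
have /H : 0 < t <= 1 by rewrite t0.
rewrite leNgt => /negP; apply.
apply: (@le_lt_trans _ _ (t * `|b|)); first by rewrite ler_pM2l// ler_norm.
rewrite /t mulrAC ltr_pdivrMr; last by lra.
by rewrite ltr_pM2l//; lra.
Qed.

Lemma prox_fin_num (R : realType) d (h : 'cV[R]_d -> \bar R) (s : R) w u :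
  0 < s -> proper_fun h -> prox (fun z => s%:E * h z)%E w u -> h u \is a fin_num.
Proof.
move=> s0 [hN [z hz]] /(_ z) uz; rewrite fin_numE hN /=.
apply/eqP => hu; move: uz hz; rewrite hu /dom /= gt0_muley ?lte_fin// addye//.
case: (h z) (hN z) => [r|//|//] _.
by rewrite -EFinM -EFinD leye_eq.
Qed.

(** Compare the minimizer [u] with the points [u + t (z - u)]: convexity gives
    the subgradient inequality up to a quadratic term, which is [t] times a
    constant after division by [t]. *)
Lemma prox_subgradient (R : realType) d (h : 'cV[R]_d -> \bar R) (s : R) w u :
  0 < s -> proper_fun h -> convex_fun h ->
  prox (fun z => s%:E * h z)%E w u -> subgradient h u (s^-1 *: (w - u)).
Proof.
move=> s0 hp hc pu; have hu := prox_fin_num s0 hp pu; split=> // z.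
move: pu; rewrite /prox /argmin /=.
case: (h u) (hp.1 u) hu (hc z u) => [a|//|//] _ _ hcu pu /=.
case: (h z) (hp.1 z) hcu => [b||//] _ hcu; last by rewrite leey.
rewrite lee_fin -subr_le0 dotZl.
rewrite -(pmulr_rle0 _ s0).
apply: (@scaled_bound_le0 _ _ (2^-1 * dot (z - u) (z - u))) => t /andP[t0 t1].
have t01 : 0 <= t <= 1 by rewrite ltW.
have := pu (t *: z + (1 - t) *: u).
have {hcu} := hcu _ t01.
rewrite -!EFinM -EFinD => hcu.
have s0E : (0 <= s%:E)%E by rewrite lee_fin ltW.
have {}hcu := lee_wpmul2l s0E hcu.
rewrite -EFinM in hcu.
move=> le1; have := le_trans le1 (leeD2r _ hcu).
rewrite -!EFinD !enorm_sqr lee_fin.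
have -> : t *: z + (1 - t) *: u - w = t *: (z - u) + (u - w).
  by apply/colP => i; rewrite !mxE; ring.
have -> : w - u = - (u - w) by rewrite opprB.
move: (z - u) (u - w) => {hc} v v'.
rewrite !dotE (dotC v').
set X := dot v v; set Y := dot v' v'; set Z := dot v v' => H.
rewrite -(ler_pM2l t0).
have -> : s * (a + s^-1 * - Z - b) = s * a - Z - s * b.
  by rewrite mulrBr mulrDr mulVKf// gt_eqF.
rewrite -subr_ge0; move: H; rewrite -subr_ge0; congr (0 <= _).
by field.
Qed.

Lemma fenchel_young (R : realType) d (h : 'cV[R]_d -> \bar R) x y :
  ((dot x y)%:E - h x <= conjugate h y)%E.
Proof. by apply: ereal_sup_ubound; exists x. Qed.

Lemma conjugate_proper (R : realType) d (h : 'cV[R]_d -> \bar R) y :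
  proper_fun h -> conjugate h y != -oo%E.
Proof.
move=> [hN [z]]; rewrite /dom /= => hz; have := fenchel_young h z y.
case: (h z) hz (hN z) => [r|//|//] _ _.
by apply: contraTneq => ->; rewrite -EFinB leeNy_eq.
Qed.

Lemma conjugate_convex (R : realType) d (h : 'cV[R]_d -> \bar R) :
  proper_fun h -> convex_fun (conjugate h).
Proof.
move=> hp y z t t01; apply: ge_ereal_sup => _ [x _ <-].
have [hN _] := hp.
case hx : (h x) (hN x) => [r||//] _; last by rewrite leNye.
have yr := fenchel_young h x y; have zr := fenchel_young h x z.
rewrite hx in yr zr; case/andP: t01 => t0 t1.
have := leeD (lee_wpmul2l (_ : 0 <= t%:E)%E yr) (lee_wpmul2l (_ : 0 <= (1 - t)%:E)%E zr).
rewrite !lee_fin subr_ge0 => /(_ t0 t1); apply: le_trans.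
by rewrite -!EFinN -!EFinD lee_fin dotDr !dotZr; lra.
Qed.

(** * Existence of proximal points and the Fenchel equality *)

Lemma trmx_continuous (R : realType) m n :
  continuous (@trmx R m n : 'M[R]_(m, n) -> 'M[R]_(n, m)).
Proof.
move=> /= M s /= /(nbhs_ballP (M^T)) [e e0 es].
apply/nbhs_ballP; exists e => //= N MN; apply: es; split=> // i j.
by rewrite !mxE; exact: MN.2.
Qed.

Lemma box_compact (R : realType) d (l u : 'cV[R]_d) :
  compact [set v : 'cV[R]_d | forall i, l i 0 <= v i 0 <= u i 0].
Proof.
have := @rV_compact R d (fun i => `[l i 0, u i 0]%classic) (fun i => @segment_compact _ _ _).
move=> /(continuous_compact (continuous_subspaceT (@trmx_continuous R 1 d))).
congr compact; apply/seteqP; split=> [_ [v /= vlu <-] i|v /= vlu].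
  by rewrite mxE; have := vlu i; rewrite in_itv.
exists v^T; last by rewrite trmxK.
by move=> i; rewrite /= mxE in_itv vlu.
Qed.

Lemma sqdist_continuous (R : realType) d (w : 'cV[R]_d) :
  continuous (fun v : 'cV[R]_d => dot (v - w) (v - w)).
Proof.
move=> v; rewrite /dot.
apply: (@cvg_big _ _ _ _ _ (@add_continuous _) _ (nbhs v) _ _ _ (nbhs_filter v)).
move=> i _.
have coord : (fun x : 'cV[R]_d => (x - w) i 0) @ v --> (v - w) i 0.
  have -> : (fun x : 'cV[R]_d => (x - w) i 0) = (fun x => x i 0 - w i 0).
    by apply/funext => x; rewrite !mxE.
  rewrite !mxE.
  by apply: (@cvgB _ _ _ (nbhs v) (nbhs_filter v)); [exact: coord_continuous|exact: cvg_cst].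
exact: (@cvgM _ _ (nbhs v) (nbhs_filter v) _ _ _ _ coord coord).
Qed.

(** The affine minorant makes the objective coercive, so minimizing it over the
    closed epigraph reduces to a compact box. Minimizing over the epigraph
    instead of the space turns lower semicontinuity into continuity. *)
Lemma prox_exists (R : realType) d (h : 'cV[R]_d -> \bar R) a c w :
  proper_fun h -> closed_fun h ->
  (forall z, (dot a z - c)%:E <= h z)%E -> exists u, prox h w u.
Proof.
move=> [hN [v0 v0h]] hcl minor.
have v0f : h v0 \is a fin_num by rewrite fin_numE hN lt_eqF.
pose phi (z : 'cV[R]_d * R) := z.2 + 2^-1 * dot (z.1 - w) (z.1 - w).
pose C := phi (v0, fine (h v0)).
pose e := dot a w - c; pose B := C - e + dot a a.
(* completing the square: <a, q> + |a|^2 + |q|^2 / 4 >= 0 for q = v - w *)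
have bound v t : (h v <= t%:E)%E -> phi (v, t) <= C ->
    dot (v - w) (v - w) <= 4 * B /\ e - dot a a - B <= t <= C.
  move=> hv; rewrite /phi /= => pC.
  have := le_trans (minor v) hv; rewrite lee_fin.
  have -> : dot a v - c = dot a (v - w) + e.
    by rewrite /e dotDr dotNr; ring.
  move=> et; have := dot_ge0 (a + 2^-1 *: (v - w)).
  have := dot_ge0 (v - w).
  move: pC et; rewrite /B; move: (v - w) => q pC et.
  rewrite !dotE (dotC q a) => ? ?.
  split; first by lra.
  by apply/andP; split; lra.
pose M := 1 + 4 * B.
pose box : set ('cV[R]_d * R) :=
  [set v : 'cV[R]_d | forall i, (w - const_mx M) i 0 <= v i 0 <= (w + const_mx M) i 0]
  `*` `[e - dot a a - B, C]%classic.
have boxE v t : (h v <= t%:E)%E -> phi (v, t) <= C -> box (v, t).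
  move=> hv pC; have [vB tC] := bound _ _ hv pC.
  split=> /=; last by rewrite in_itv.
  move=> i; rewrite !mxE.
  have := le_trans (dot_coord (v - w) i) vB; rewrite !mxE.
  have : 0 <= 4 * B by apply: le_trans vB; exact: dot_ge0.
  rewrite /M => B0 vw.
  suff : `|v i 0 - w i 0| <= 1 + 4 * B by rewrite ler_norml; lra.
  rewrite -(@ler_pXn2r _ 2) ?nnegrE ?normr_ge0//; last by lra.
  by rewrite real_normK ?num_real//; nra.
have cE : compact (box `&` epigraph h).
  apply: compact_closedI => //; apply: compact_setX; first exact: box_compact.
  exact: segment_compact.
have cphi : continuous phi.
  move=> z; apply: cvgD; first exact: cvg_snd.
  apply: cvgM; first exact: cvg_cst.
  exact: (continuous_comp (@cvg_fst _ _ _ _ _) (@sqdist_continuous _ _ w z.1)).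
have v0E : (box `&` epigraph h) (v0, fine (h v0)).
  by split; [apply: boxE|]; rewrite /epigraph /= ?fineK.
have [|[u t] uE umin] := compact_EVT_min _ cE (continuous_subspaceT cphi).
  by exists (v0, fine (h v0)).
have hu : (h u <= t%:E)%E by move: uE; rewrite inE => -[].
exists u => z.
have [hz|hz] := eqVneq (h z) +oo%E; first by rewrite hz addye// leey.
have zf : h z \is a fin_num by rewrite fin_numE hN hz.
apply: (@le_trans _ _ (phi (u, t))%:E).
  by rewrite /phi EFinD /= enorm_sqr leeD2r.
rewrite -(fineK zf) -EFinD lee_fin enorm_sqr -/(phi (z, fine (h z))).
have [zC|/ltW Cz] := leP (phi (z, fine (h z))) C.
  by apply: umin; rewrite inE; split; [apply: boxE|]; rewrite /epigraph /= ?fineK.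
by apply: le_trans Cz; apply: umin; rewrite inE.
Qed.

Lemma subgradient_conjugate (R : realType) d (h : 'cV[R]_d -> \bar R) u v :
  subgradient h u v ->
  conjugate h v = (dot u v - fine (h u))%:E /\ subgradient (conjugate h) v u.
Proof.
move=> [hu sub].
have cE : conjugate h v = (dot u v - fine (h u))%:E.
  apply/eqP; rewrite eq_le; apply/andP; split; last first.
    by have := fenchel_young h u v; rewrite -{1}(fineK hu) -EFinB.
  apply: ge_ereal_sup => _ [z _ <-]; have := sub z.
  case: (h z) => [r|_|]; last by rewrite leeNy_eq.
    by rewrite -EFinB !lee_fin dotDr dotNr (dotC z) (dotC u); lra.
  by rewrite /= leNye.
split=> //; split; first by rewrite cE.
move=> z; rewrite cE /=; apply: le_trans (fenchel_young h u z).
by rewrite -{2}(fineK hu) -EFinB lee_fin dotDr dotNr; lra.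
Qed.

(** Biconjugation at points of the graph of the conjugate subdifferential. A
    proximal step of [h] from [u + v] gives [r] and the subgradient
    [v' = u + v - r] of [h] at [r]; then [u] and [r] are subgradients of the
    conjugate at [v] and [v'], and monotonicity reads [- |u - r|^2 >= 0]. Hence
    [u = r], where the Fenchel equality is known. *)
Lemma fenchel_equality_of_conjugate (R : realType) d (h : 'cV[R]_d -> \bar R) u v :
  proper_closed_convex h -> subgradient (conjugate h) v u ->
  h u = (dot u v - fine (conjugate h v))%:E.
Proof.
move=> [hp hcl hcv] [cv sub].
have minor z : ((dot v z - fine (conjugate h v))%:E <= h z)%E.
  have := fenchel_young h z v; rewrite -(fineK cv) dotC.
  case: (h z) (hp.1 z) => [r|//|//] _; rewrite ?leey// -EFinB !lee_fin /=; lra.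
have [r pr] := prox_exists (u + v) hp hcl minor.
have /(prox_subgradient ltr01 hp hcv) : prox (fun z => 1%:E * h z)%E (u + v) r.
  by rewrite (_ : (fun z => 1%:E * h z)%E = h)//; apply/funext => z; rewrite mul1e.
rewrite invr1 scale1r; set v' := u + v - r => sr.
have [cE [cv' sub']] := subgradient_conjugate sr.
have := sub v'; have := sub' v; rewrite -(fineK cv) -(fineK cv') !lee_fin /= => H1 H2.
have : dot (u - r) (u - r) <= 0.
  have e1 : v - v' = - (u - r).
    by apply/colP => i; rewrite !mxE; ring.
  have e2 : v' - v = u - r.
    by apply/colP => i; rewrite !mxE; ring.
  rewrite e1 in H1; rewrite e2 in H2; move: H1 H2.
  rewrite dotNr (dotDl u) dotNl; lra.
move=> /dot_eq0/eqP; rewrite subr_eq0 => /eqP ur.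
move: cE sr.1; rewrite /v' -ur [u + v]addrC addrK => -> uf.
by rewrite /= opprB addrC subrK fineK.
Qed.

(** * Supporting functionals of convex sets *)

(** Finite-dimensional Hahn-Banach theorem, one coordinate at a time. [Q] is a
    convex cone of pairs (point, value), and a functional lying below [Q] on
    the span of the first [k] coordinates is extended to the next one by
    choosing a slope. The slope has to lie between two families of bounds, one
    from the points of [Q] with next coordinate -1 and one from those with
    coordinate 1; adding a point of each kind and using the functional already
    built shows that the families are separated. The last hypothesis makes
    them both empty or both nonempty, so the supremum of the lower one is
    always a valid slope. *)
Lemma cone_majorant_coord (R : realType) n (Q : 'cV[R]_n -> R -> Prop) k :
  (forall u v s t, Q u s -> Q v t -> Q (u + v) (s + t)) ->
  (forall a u t, 0 < a -> Q u t -> Q (a *: u) (a * t)) ->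
  (forall t, Q 0 t -> 0 <= t) ->
  (forall u t, Q u t -> exists t', Q (- u) t') ->
  exists y : 'cV[R]_n, forall (u : 'cV[R]_n) t,
    (forall i : 'I_n, (k <= i)%N -> u i 0 = 0) -> Q u t -> dot y u <= t.
Proof.
move=> QD QZ Q0 QN; elim: k => [|k [y Hy]].
  exists 0 => u t u0; have -> : u = 0 by apply/colP => i; rewrite mxE u0.
  by move/Q0; rewrite dot0l.
have [nk|kn] := leqP n k.
  exists y => u t uk; apply: Hy => i ki.
  by have := ltn_ord i; rewrite ltnNge (leq_trans nk ki).
pose j := Ordinal kn.
pose flat (u : 'cV[R]_n) := forall i : 'I_n, (k < i)%N -> u i 0 = 0.
pose A : set R := [set dot y w.1 - w.2 |
  w in [set w : 'cV[R]_n * R | [/\ flat w.1, w.1 j 0 = -1 & Q w.1 w.2]]].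
(* every lower bound for the new slope is below every upper bound *)
have gap u t v s : flat u -> u j 0 = 1 -> Q u t ->
    flat v -> v j 0 = -1 -> Q v s -> dot y v - s <= t - dot y u.
  move=> fu uj Qu fv vj Qv.
  suff : dot y (u + v) <= t + s by rewrite dotDr; lra.
  apply: Hy; last exact: QD.
  move=> i; rewrite leq_eqVlt => /orP[/eqP ki|ki]; rewrite mxE.
    have -> : i = j by exact: val_inj.
    by rewrite uj vj subrr.
  by rewrite fu// fv// addr0.
exists (y + sup A *: delta_mx j 0) => u t fu Qu.
have dj (v : 'cV[R]_n) : dot (delta_mx j 0) v = v j 0.
  rewrite /dot (bigD1 j) //= mxE !eqxx mul1r big1 ?addr0// => i ij.
  by rewrite mxE (negbTE ij) mul0r.
rewrite dotDl dotZl dj.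
have flatZ a (v : 'cV[R]_n) : flat v -> flat (a *: v).
  by move=> fv i ki; rewrite mxE fv// mulr0.
have [uj|uj|uj] := ltgtP (u j 0) 0.
- pose a := (- u j 0)^-1.
  have a0 : 0 < a by rewrite invr_gt0 oppr_gt0.
  have auj : (a *: u) j 0 = -1.
    by rewrite mxE /a invrN mulNr mulVf// lt_eqF.
  have Qa := QZ _ _ _ a0 Qu.
  have [t' Qt'] := QN _ _ Qa.
  have : dot y (a *: u) - a * t <= sup A.
    apply: ub_le_sup; last by exists (a *: u, a * t) => //; split => //; exact: flatZ.
    exists (t' - dot y (- (a *: u))) => _ [[v s] /= [fv vj Qv] <-].
    apply: gap => //; last by rewrite mxE auj opprK.
    by move=> i ki; rewrite mxE (flatZ a _ fu)// oppr0.
  rewrite dotZr -mulrBr /a ler_pdivrMl ?oppr_gt0// => H.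
  by move: H; rewrite mulNr mulrC; lra.
- pose a := (u j 0)^-1.
  have a0 : 0 < a by rewrite invr_gt0.
  have auj : (a *: u) j 0 = 1 by rewrite mxE mulVf// gt_eqF.
  have Qa := QZ _ _ _ a0 Qu.
  have [t' Qt'] := QN _ _ Qa.
  have : sup A <= a * t - dot y (a *: u).
    apply: ge_sup.
      exists (dot y (- (a *: u)) - t'), (- (a *: u), t') => //=; split => //.
      - by move=> i ki; rewrite mxE (flatZ a _ fu)// oppr0.
      - by rewrite mxE auj.
    move=> _ [[v s] /= [fv vj Qv] <-].
    by apply: gap => //; exact: flatZ.
  rewrite dotZr -mulrBr /a ler_pdivlMl// mulrC => H; lra.
- rewrite uj mulr0 addr0; apply: Hy => // i.
  rewrite leq_eqVlt => /orP[/eqP ki|]; last exact: fu.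
  by have -> : i = j by exact: val_inj.
Qed.

Lemma cone_majorant (R : realType) n (Q : 'cV[R]_n -> R -> Prop) :
  (forall u v s t, Q u s -> Q v t -> Q (u + v) (s + t)) ->
  (forall a u t, 0 < a -> Q u t -> Q (a *: u) (a * t)) ->
  (forall t, Q 0 t -> 0 <= t) ->
  (forall u t, Q u t -> exists t', Q (- u) t') ->
  exists y : 'cV[R]_n, forall u t, Q u t -> dot y u <= t.
Proof.
move=> QD QZ Q0 QN; have [y Hy] := @cone_majorant_coord _ _ _ n QD QZ Q0 QN.
exists y => u t; apply: Hy => i; by rewrite leqNgt ltn_ord.
Qed.

(** Supporting functional at the origin of a convex set [E] of pairs (point,
    value): the cone generated by [E] satisfies the hypotheses of
    [cone_majorant]. The symmetry condition, which says that the domain of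
    [E] surrounds the origin relatively to its span, excludes a vertical
    supporting hyperplane. *)
Lemma convex_majorant (R : realType) n (E : 'cV[R]_n -> R -> Prop) :
  (forall u v s t a, 0 < a < 1 -> E u s -> E v t ->
     E (a *: u + (1 - a) *: v) (a * s + (1 - a) * t)) ->
  (forall t, E 0 t -> 0 <= t) ->
  (forall u t, E u t -> exists2 a, 0 < a & exists t', E (- (a *: u)) t') ->
  exists y : 'cV[R]_n, forall u t, E u t -> dot y u <= t.
Proof.
move=> Ec E0 EN.
pose Q u t := exists2 a : R, 0 < a & E (a *: u) (a * t).
have [||||y Hy] := @cone_majorant _ n Q.
- move=> u v s t [a a0 Eu] [b b0 Ev].
  exists (a * b / (a + b)); first by rewrite divr_gt0 ?mulr_gt0 ?addr_gt0.
  have ab : a + b != 0 by rewrite gt_eqF ?addr_gt0.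
  have -> : (a * b / (a + b)) *: (u + v) =
      (b / (a + b)) *: (a *: u) + (1 - b / (a + b)) *: (b *: v).
    by rewrite !scalerA scalerDr; congr (_ *: _ + _ *: _); field.
  have -> : a * b / (a + b) * (s + t) =
      b / (a + b) * (a * s) + (1 - b / (a + b)) * (b * t) by field.
  apply: Ec => //.
  rewrite divr_gt0 ?addr_gt0//= ltr_pdivrMr ?addr_gt0// mul1r.
  by rewrite ltrDr.
- move=> a u t a0 [b b0 Eu]; exists (b / a); first by rewrite divr_gt0.
  rewrite scalerA (_ : b / a * a = b) ?mulrA ?divfK ?gt_eqF//.
- by move=> t [a a0]; rewrite scaler0 => /E0; rewrite pmulr_rge0.
- move=> u t [a a0 /EN[b b0 [t' Et']]]; exists ((b * a)^-1 * t').
  exists (b * a); first by rewrite mulr_gt0.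
  by rewrite scalerN -scalerA mulrA divff ?mul1r// gt_eqF ?mulr_gt0.
by exists y => u t Eu; apply: Hy; exists 1 => //; rewrite scale1r mul1r.
Qed.

(** * Duality under the relative interior condition *)

Lemma primal_val_argmin (R : realType) p n (f : 'cV[R]_p -> \bar R)
    (g : 'cV[R]_n -> \bar R) (K : 'M[R]_(n, p)) xs :
  argmin (primal f g K) xs -> primal_val f g K = primal f g K xs.
Proof.
move=> xs_opt; apply/eqP; rewrite eq_le; apply/andP; split.
  by apply: ereal_inf_lbound; exists xs.
by apply: le_ereal_inf_tmp => _ [z _ <-]; exact: xs_opt.
Qed.

(** The point [- a u = (1 + a) 0 - a u] is an affine combination of 0 and [u]. *)
Lemma rel_interior_opposite (R : realType) n (C : set 'cV[R]_n) u :
  rel_interior C 0 -> C u -> exists2 a : R, 0 < a & C (- (a *: u)).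
Proof.
move=> [C0h [e e0 eC]] Cu.
have C0 : C 0 by apply: eC => //; rewrite subrr enorm0.
have u0 := enorm_ge0 u.
pose a := e / (1 + enorm u).
have a0 : 0 < a by rewrite divr_gt0//; lra.
exists a => //; apply: eC.
  exists 2, (fun i => if i == 0 then 0 else u), (fun i => if i == 0 then 1 + a else - a).
  split.
  - by move=> i; case: ifP.
  - by rewrite big_ord_recl big_ord1/=; lra.
  - by rewrite big_ord_recl big_ord1/= scaler0 add0r scaleNr.
rewrite subr0 -scaleNr enormZ normrN gtr0_norm// /a mulrAC ltr_pdivrMr; last by lra.
by rewrite ltr_pM2l//; lra.
Qed.

Lemma primal_opt_fin_num (R : realType) p n (f : 'cV[R]_p -> \bar R)
    (g : 'cV[R]_n -> \bar R) (K : 'M[R]_(n, p)) xs :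
  proper_fun f -> proper_fun g -> rel_interior (dom_diff f g K) 0 ->
  argmin (primal f g K) xs -> f xs \is a fin_num /\ g (K *m xs) \is a fin_num.
Proof.
move=> [fN _] [gN _] [C0h [e e0 eC]] xs_opt.
have [||w gw [z fz wz]] := eC 0 => //; first by rewrite subrr enorm0.
move: wz => /eqP; rewrite subr_eq0 => /eqP wz; rewrite wz in gw.
have : (primal f g K xs < +oo)%E.
  by apply: (le_lt_trans (xs_opt z)); rewrite /primal lte_add_pinfty.
rewrite /primal !fin_numE !fN !gN /=.
by case: (f xs) (fN xs) => [a| |]; case: (g (K *m xs)) (gN (K *m xs)) => [b| |].
Qed.

(** Fenchel-Rockafellar duality: the perturbed problem inf over x of
    f x + g (K x + u) has at u = 0 a supporting affine function, whose slope [y]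
    has the required dual value. The set [E] below is, up to attainment, the
    epigraph of the perturbation function, shifted to vanish at 0. *)
Lemma dual_attained (R : realType) p n (f : 'cV[R]_p -> \bar R)
    (g : 'cV[R]_n -> \bar R) (K : 'M[R]_(n, p)) xs :
  proper_fun f -> convex_fun f -> proper_fun g -> convex_fun g ->
  rel_interior (dom_diff f g K) 0 -> argmin (primal f g K) xs ->
  exists y, (dual f g K y <= - primal f g K xs)%E.
Proof.
move=> fp fc gp gc ri xs_opt.
have [fxs gxs] := primal_opt_fin_num fp gp ri xs_opt.
have [fN _] := fp; have [gN _] := gp.
pose Fs := fine (f xs) + fine (g (K *m xs)).
have FsE : primal f g K xs = Fs%:E by rewrite /primal -(fineK fxs) -(fineK gxs).
pose E u t := exists x w a b,
  [/\ f x = a%:E, g w = b%:E, u = w - K *m x & a + b - Fs <= t].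
have convex_val d (h : 'cV[R]_d -> \bar R) z z' a b t : convex_fun h ->
    (forall v, h v != -oo%E) -> 0 <= t <= 1 -> h z = a%:E -> h z' = b%:E ->
    exists2 e, h (t *: z + (1 - t) *: z') = e%:E & e <= t * a + (1 - t) * b.
  move=> hc hN t01 hz hz'; have := hc z z' t t01; rewrite hz hz' -!EFinM -EFinD.
  case: (h _) (hN (t *: z + (1 - t) *: z')) => [e|//|//] _.
  by rewrite lee_fin; exists e.
have [|||y Hy] := @convex_majorant R n E.
- move=> u v s t a /andP[a0 a1] [x1 [w1 [a1' [b1 [fx1 gw1 -> H1]]]]].
  move=> [x2 [w2 [a2 [b2 [fx2 gw2 -> H2]]]]].
  have a01 : 0 <= a <= 1 by rewrite !ltW.
  have [e fe eH] := convex_val _ _ _ _ _ _ _ fc fN a01 fx1 fx2.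
  have [e' ge' eH'] := convex_val _ _ _ _ _ _ _ gc gN a01 gw1 gw2.
  exists (a *: x1 + (1 - a) *: x2), (a *: w1 + (1 - a) *: w2), e, e'.
  split=> //.
    by rewrite mulmxDr -!scalemxAr; apply/colP => i; rewrite !mxE; ring.
  by nra.
- move=> t [z [w [a [b [fz gw /esym/eqP]]]]]; rewrite subr_eq0 => /eqP wz.
  by apply: le_trans; rewrite subr_ge0 -lee_fin -FsE EFinD -fz -gw wz; exact: xs_opt.
- move=> u t [z [w [a [b [fz gw -> _]]]]].
  have [|e e0 [w' gw' [z' fz' wz']]] := @rel_interior_opposite R n _ (w - K *m z) ri.
    by exists w; [rewrite /dom /= gw ltry|exists z; rewrite // /dom /= fz ltry].
  exists e => //; rewrite -wz'.
  have fzf : f z' \is a fin_num by rewrite fin_numE fN lt_eqF.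
  have gwf : g w' \is a fin_num by rewrite fin_numE gN lt_eqF.
  exists (fine (f z') + fine (g w') - Fs), z', w', (fine (f z')), (fine (g w')).
  by rewrite !fineK.
exists y; rewrite FsE.
have main z w a b : f z = a%:E -> g w = b%:E ->
    dot w y - b <= - Fs - (dot z (- (K^T *m y)) - a).
  move=> fz gw.
  have /Hy : E (w - K *m z) (a + b - Fs) by exists z, w, a, b.
  by rewrite dotDr !dotNr (dotC y w) (dotC y) dot_adjoint; lra.
have gle a z : f z = a%:E ->
    (conjugate g y <= (- Fs - (dot z (- (K^T *m y)) - a))%:E)%E.
  move=> fz; apply: ge_ereal_sup => _ [w _ <-].
  case gw : (g w) (gN w) => [b||//] _; last by rewrite /= leNye.
  by rewrite -EFinB lee_fin; exact: main fz gw.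
have fxsE := esym (fineK fxs).
have gf : conjugate g y \is a fin_num.
  rewrite fin_numE conjugate_proper//= lt_eqF//.
  exact: le_lt_trans (gle _ _ fxsE) (ltry _).
rewrite /dual -(fineK gf) -leeBrDr// -EFinN -EFinB.
apply: ge_ereal_sup => _ [z _ <-].
case fz : (f z) (fN z) => [a||//] _; last by rewrite /= leNye.
have := gle _ _ fz; rewrite -(fineK gf) -EFinB !lee_fin; lra.
Qed.

(** Any dual optimum [ys] does as well as the one of [dual_attained], and then
    minimizing the Lagrangian over [x] at [ys] gives minus the dual value. *)
Lemma dual_opt_saddle (R : realType) p n (f : 'cV[R]_p -> \bar R)
    (g : 'cV[R]_n -> \bar R) (K : 'M[R]_(n, p)) xs ys :
  proper_fun f -> convex_fun f -> proper_fun g -> convex_fun g ->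
  rel_interior (dom_diff f g K) 0 -> argmin (primal f g K) xs ->
  argmin (dual f g K) ys ->
  conjugate g ys \is a fin_num /\
  forall x, (primal f g K xs <= lagrangian f g K x ys)%E.
Proof.
move=> fp fc gp gc ri xs_opt ys_opt.
have [y yle] := dual_attained fp fc gp gc ri xs_opt.
have [fxs gxs] := primal_opt_fin_num fp gp ri xs_opt.
have := le_trans (ys_opt y) yle; rewrite /dual /primal.
rewrite -(fineK fxs) -(fineK gxs) -EFinD.
have := conjugate_proper (- (K^T *m ys)) fp.
have FY x := fenchel_young f x (- (K^T *m ys)).
have := conjugate_proper ys gp; rewrite /lagrangian.
case: (conjugate g ys) => [G||]//; last first.
  by case: (conjugate f _) => [A||]//= _ _.
case cf : (conjugate f _) => [A||]//= _ _.
rewrite -EFinD lee_fin => AG; split=> // z.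
have := FY z; rewrite cf.
case: (f z) (fp.1 z) => [a||]// _; last by rewrite /= leey.
by rewrite -?EFinB -?EFinD !lee_fin dotNr dot_adjoint; lra.
Qed.

(** * One iteration of the algorithm *)

Lemma three_point_identity (R : realType) d (a b z : 'cV[R]_d) :
  2 * dot (a - b) (b - z) =
  dot (a - z) (a - z) - dot (b - z) (b - z) - dot (a - b) (a - b).
Proof.
rewrite /dot mulr_sumr -!sumrN -!big_split /=; apply: eq_bigr => i _.
by rewrite !mxE; ring.
Qed.

(** With [w = ud - (1 - t) u], the term [<yt - y, w>] is, up to a multiple of
    [|w|^2], a difference of squared distances to [y] because [w] is the
    direction of the multiplier update, and [<ud, w>] is likewise a difference
    of squared residuals. The multiplier step [(1 - gamma) rho] is shorter than
    [rho], which leaves the positive term [gamma rho |w|^2]. *)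
Lemma multiplier_identity (R : realType) n (rho gamma t : R) (ud u w d yt y : 'cV[R]_n) :
  rho != 0 -> 1 - gamma != 0 -> w = ud - (1 - t) *: u ->
  2 * dot (yt + rho *: (ud - d) - y) w =
  ((1 - gamma) * rho)^-1 *
    (dot (yt + ((1 - gamma) * rho) *: w - y) (yt + ((1 - gamma) * rho) *: w - y)
     - dot (yt - y) (yt - y))
  + rho * (dot ud ud - (1 - t) ^+ 2 * dot u u)
  + gamma * rho * dot w w - 2 * rho * dot d w.
Proof.
move=> r0 g0 ->; rewrite /dot !mulr_sumr -!sumrN -!big_split /= !mulr_sumr.
rewrite -?sumrN -!big_split /=.
by apply: eq_bigr => i _; rewrite !mxE; field; rewrite r0 g0.
Qed.

Lemma weighted_young (R : realType) n (gamma : R) (d w : 'cV[R]_n) :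
  0 < gamma -> 2 * dot d w <= gamma^-1 * dot d d + gamma * dot w w.
Proof.
move=> g0; have := dot_ge0 (d - gamma *: w).
rewrite !dotE (dotC w d) => H.
rewrite -subr_ge0 -(pmulr_rge0 _ g0).
have -> : gamma * (gamma^-1 * dot d d + gamma * dot w w - 2 * dot d w) =
  dot d d + gamma ^+ 2 * dot w w - 2 * gamma * dot d w.
  by field; rewrite gt_eqF.
by move: H; congr (0 <= _); ring.
Qed.

(** One iteration, from [x], [xh], [r], [yt] to [xp], [rp], [yp]. The four
    hypotheses on function values are the subgradient inequalities for the
    x-step and the y-step, at the previous iterate with weight [1 - t] and at
    the solution with weight [t]. Their sum leaves the cross term
    [rho <K (xp - xh), w>], which is split by [weighted_young] so that one half
    is absorbed by the [gamma rho |w|^2] of [multiplier_identity] and the other,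
    by the choice of [beta], by the [|xp - xh|^2 / beta] of
    [three_point_identity]. The first two hypotheses carry the factor
    [1 - t] because nothing is known about the starting point, where
    [t = 1]. *)
Lemma pd_one_step (R : realType) p n (K : 'M[R]_(n, p)) (rho gamma t : R)
    (x xh xp xs : 'cV[R]_p) (r rp yt yp y : 'cV[R]_n) (fx fxp fs th thp gs : R) :
  let beta := gamma / (opnorm K ^+ 2 * rho) in
  let eta := (1 - gamma) * rho in
  let q := beta^-1 *: (xh - beta *: (K^T *m yp) - xp) in
  let u := K *m x - r in
  let up := K *m xp - rp in
  let w := up - (1 - t) *: u in
  let xi := (1 - t) *: x + t *: xs in
  K != 0 -> 0 < rho -> 0 < gamma < 1 -> 0 <= t ->
  0 <= (1 - t) * (fx - fxp - dot q (x - xp)) ->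
  0 <= (1 - t) * (th - thp - dot yp (r - rp)) ->
  fxp + dot q (xs - xp) <= fs ->
  thp + dot yp (K *m xs - rp) <= gs ->
  yp = yt + rho *: (K *m xh - rp) ->
  2 * (fxp + thp + dot y up - (fs + gs)) + rho * dot up up
    + beta^-1 * dot (xp - xi) (xp - xi)
    + eta^-1 * dot (yt + eta *: w - y) (yt + eta *: w - y)
  <= 2 * (1 - t) * (fx + th + dot y u - (fs + gs)) + (1 - t) ^+ 2 * rho * dot u u
    + beta^-1 * dot (xh - xi) (xh - xi)
    + eta^-1 * dot (yt - y) (yt - y).
Proof.
move=> beta eta q u up w xi K0 r0 /andP[g0 g1] t0 Hx Hr Hxs Hys ypE.
have oK := opnorm_gt0 K0.
have b0 : 0 < beta by rewrite divr_gt0// mulr_gt0// exprn_gt0.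
have qE z : dot q z = beta^-1 * dot (xh - xp) z - dot yp (K *m z).
  have -> : q = beta^-1 *: (xh - xp) - K^T *m yp.
    rewrite /q addrAC scalerBr scalerA mulVf ?scale1r// gt_eqF//.
  rewrite (dotDl (beta^-1 *: (xh - xp))) (dotZl beta^-1); congr (_ + _).
  by rewrite dotNl dot_adjoint trmxK.
rewrite !qE in Hx Hxs.
have E1 : (1 - t) * dot (xh - xp) (x - xp) + t * dot (xh - xp) (xs - xp)
    = - dot (xh - xp) (xp - xi).
  by rewrite -!dotZr -dotDr -dotNr; congr dot; apply/colP => i; rewrite !mxE; ring.
have E2 : (1 - t) * (dot yp (r - rp) - dot yp (K *m (x - xp))) +
    t * (dot yp (K *m xs - rp) - dot yp (K *m (xs - xp))) = dot yp w.
  rewrite -!dotNr -!dotDr -!dotZr -!dotDr; congr dot.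
  by rewrite /w /up /u !mulmxBr; apply/colP => i; rewrite !mxE; ring.
have E3 := three_point_identity xh xp xi.
have E4 : dot yp w - dot y w = dot (yt + rho *: (up - K *m (xp - xh)) - y) w.
  rewrite -dotNl -dotDl ypE; congr dot.
  by rewrite /up mulmxBr; apply/colP => i; rewrite !mxE; ring.
have E5 := @multiplier_identity R n rho gamma t up u w (K *m (xp - xh)) yt y.
rewrite -/eta in E5.
have gn : 0 < 1 - gamma by rewrite subr_gt0.
have {}E5 := E5 (lt0r_neq0 r0) (lt0r_neq0 gn) erefl.
have E6 : rho * (2 * dot (K *m (xp - xh)) w) <=
    rho * (gamma^-1 * dot (K *m (xp - xh)) (K *m (xp - xh)) + gamma * dot w w).
  by rewrite ler_pM2l// weighted_young.
have E7 : rho * gamma^-1 * dot (K *m (xp - xh)) (K *m (xp - xh)) <=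
    beta^-1 * dot (xh - xp) (xh - xp).
  have -> : beta^-1 = rho * gamma^-1 * opnorm K ^+ 2.
    by rewrite /beta; field; rewrite !gt_eqF.
  rewrite -[leRHS]mulrA ler_pM2l ?mulr_gt0 ?invr_gt0//.
  rewrite -!enorm_sqr -exprMn -[xh - xp]opprB.
  have -> : enorm (- (xp - xh)) = enorm (xp - xh) by rewrite /enorm dotNl dotNr opprK.
  by rewrite ler_pXn2r ?nnegrE ?mulr_ge0 ?enorm_ge0 ?opnorm_le ?ltW.
have E8 : dot y w = dot y up - (1 - t) * dot y u.
  by rewrite /w dotDr dotNr dotZr.
have Hxs' : 0 <= t * (fs - fxp -
    (beta^-1 * dot (xh - xp) (xs - xp) - dot yp (K *m (xs - xp)))).
  by rewrite mulr_ge0//; lra.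
have Hys' : 0 <= t * (gs - thp - dot yp (K *m xs - rp)).
  by rewrite mulr_ge0//; lra.
have E1' : beta^-1 *
    ((1 - t) * dot (xh - xp) (x - xp) + t * dot (xh - xp) (xs - xp)) =
    - beta^-1 * dot (xh - xp) (xp - xi) by rewrite E1; ring.
have E3' : beta^-1 * (2 * dot (xh - xp) (xp - xi)) = beta^-1 *
    (dot (xh - xi) (xh - xi) - dot (xp - xi) (xp - xi)
     - dot (xh - xp) (xh - xp)) by rewrite E3.
(* the terms in |xp - xh|^2 cancel by E7, those in |w|^2 between E5 and E6 *)
lra.
Qed.

(** * Descent along the iterates *)

(** The left-hand side at [k] exceeds the right-hand side at [k + 1] by
    [(c - 1) S (k + 1)] plus a multiple of [((k + c)^2 - (k + 1)^2) b (k + 1)],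
    and [(k + c)^2 - (k + 1)^2 >= 2 (c - 1) (k + 1)]. This slack, positive for
    [c > 1], is what can be summed. *)
Lemma descent_rates (R : realType) (c rho0 : R) (S b A : nat -> R) :
  1 < c -> 0 < rho0 -> (forall k, 0 <= S k.+1) -> (forall k, 0 <= b k) ->
  (forall k, 0 <= A k) ->
  (forall k, (k%:R + c) * S k.+1 + rho0 / (2 * c) * (k%:R + c) ^+ 2 * b k.+1 + A k.+1
     <= k%:R * S k + rho0 / (2 * c) * k%:R ^+ 2 * b k + A k) ->
  [/\ forall k, (k%:R + c) * S k.+1 <= A 0,
      forall k, rho0 / (2 * c) * (k%:R + c) ^+ 2 * b k.+1 <= A 0 &
      exists B, forall N, \sum_(1 <= k < N) (S k + k%:R * b k) <= B].
Proof.
move=> c1 r0 S0 b0 A0 desc.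
set q := rho0 / (2 * c) in desc *.
have q0 : 0 < q by rewrite divr_gt0//; lra.
pose G k := (k%:R + c) * S k.+1 + q * (k%:R + c) ^+ 2 * b k.+1 + A k.+1.
pose m := Order.min (c - 1) (q * (2 * (c - 1))).
have m0 : 0 < m by rewrite lt_min; apply/andP; split; [lra|rewrite mulr_gt0//; lra].
have m1 : m <= c - 1 by rewrite ge_min lexx.
have m2 : m <= q * (2 * (c - 1)) by rewrite ge_min lexx orbT.
have tele N : m * \sum_(1 <= k < N.+1) (S k + k%:R * b k) + G N <= A 0.
  elim: N => [|N IH].
    rewrite big_geq// mulr0 add0r; have := desc 0.
    by rewrite /G mul0r expr0n/= mulr0 !mul0r !add0r.
  rewrite big_nat_recr//= mulrDr.
  suff : G N.+1 + m * (S N.+1 + N.+1%:R * b N.+1) <= G N by lra.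
  have := desc N.+1; rewrite -/(G N.+1) => H.
  apply: le_trans (lerD H (lexx _)) _; rewrite /G.
  have e1 : m * S N.+1 <= (c - 1) * S N.+1 by rewrite ler_wpM2r.
  have nb : 0 <= N.+1%:R * b N.+1 by rewrite mulr_ge0.
  have e2 := ler_wpM2r nb m2.
  have e3 : 0 <= q * (c - 1) ^+ 2 * b N.+1.
    by rewrite mulr_ge0// mulr_ge0 ?sqr_ge0// ltW.
  rewrite -(natr1 N) in e2 *; rewrite -subr_ge0.
  have -> : (N%:R + c) * S N.+1 + q * (N%:R + c) ^+ 2 * b N.+1 + A N.+1 -
     ((N%:R + 1) * S N.+1 + q * (N%:R + 1) ^+ 2 * b N.+1 + A N.+1
      + m * (S N.+1 + (N%:R + 1) * b N.+1))
   = ((c - 1) * S N.+1 - m * S N.+1)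
     + (q * (2 * (c - 1)) * ((N%:R + 1) * b N.+1) - m * ((N%:R + 1) * b N.+1))
     + q * (c - 1) ^+ 2 * b N.+1 by ring.
  by rewrite addr_ge0 // addr_ge0 // subr_ge0.
have sum0 N : 0 <= \sum_(1 <= k < N) (S k + k%:R * b k).
  rewrite big_nat_cond; apply: sumr_ge0 => -[|k]// _.
  by rewrite addr_ge0// mulr_ge0.
have kc k : 0 < k%:R + c :> R by rewrite ltr_wpDl//; lra.
have GA k : G k <= A 0.
  by apply: le_trans (tele k); rewrite lerDr mulr_ge0// ltW.
have G1 k : 0 <= (k%:R + c) * S k.+1 by rewrite mulr_ge0 ?(ltW (kc k)).
have G2 k : 0 <= q * (k%:R + c) ^+ 2 * b k.+1 by rewrite mulr_ge0// mulr_ge0 ?sqr_ge0// ltW.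
split=> [k|k|].
- by have := GA k; have := G2 k; have := A0 k.+1; rewrite /G; lra.
- by have := GA k; have := G1 k; have := A0 k.+1; rewrite /G; lra.
- exists (A 0 / m) => -[|N]; first by rewrite big_geq// divr_ge0// ltW.
  rewrite ler_pdivlMr// mulrC; apply: le_trans (tele N); rewrite lerDl.
  by rewrite /G !addr_ge0.
Qed.

(** The Lagrangian of the split problem min f x + g r subject to K x = r, with
    [g r] replaced by [<r, y> - conjugate g y]; the two agree when [r] is a
    subgradient of the conjugate at [y]. *)
Definition split_lagrangian (R : realType) p n (f : 'cV[R]_p -> \bar R)
  (g : 'cV[R]_n -> \bar R) (K : 'M[R]_(n, p)) (x : 'cV[R]_p) (r y v : 'cV[R]_n) : R :=
  fine (f x) + (dot r y - fine (conjugate g y)) + dot v (K *m x - r).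

(** [r (k + 1)] is the subgradient of the conjugate of [g] at [y (k + 1)] that
    the dual proximal step provides; the update of [ytilde] is then a multiplier
    step along [u (k + 1) - (1 - tau k) u k] for the residuals [u = K x - r].
    [A] collects the squared distances of an extrapolated point (called [Z],
    relatively to the solution) and of [ytilde] to [xs] and [ys]. Multiplying
    [pd_one_step] by [(k + c) / 2] makes the coefficients of [A] constant. *)
Lemma pd_descent (R : realType) p n (f : 'cV[R]_p -> \bar R)
    (g : 'cV[R]_n -> \bar R) (K : 'M[R]_(n, p)) (xs : 'cV[R]_p) (ys : 'cV[R]_n)
    (rho0 c gamma : R) (x0 : 'cV[R]_p) (y0 : 'cV[R]_n)
    (x xhat : nat -> 'cV[R]_p) (y ytilde ybar : nat -> 'cV[R]_n) :
  proper_fun f -> convex_fun f -> proper_fun g -> K != 0 ->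
  f xs \is a fin_num -> g (K *m xs) \is a fin_num ->
  conjugate g ys \is a fin_num ->
  0 < rho0 -> 1 < c -> 0 < gamma < 1 ->
  pd_iterates f g K rho0 c gamma x0 y0 x xhat y ytilde ybar ->
  exists (r : nat -> 'cV[R]_n) (A : nat -> R),
  let S k := split_lagrangian f g K (x k) (r k) (y k) ys
    - (fine (f xs) + fine (g (K *m xs))) in
  let b k := dot (K *m x k - r k) (K *m x k - r k) in
  [/\ A 0 = c / 2 * (rho0 * opnorm K ^+ 2 / gamma * enorm (x0 - xs) ^+ 2
               + ((1 - gamma) * rho0)^-1 * enorm (y0 - ys) ^+ 2),
      forall k, 0 <= A k,
      forall k, f (x k.+1) \is a fin_num,
      forall k, subgradient (conjugate g) (y k.+1) (r k.+1) &
      forall k, (k%:R + c) * S k.+1 + rho0 / (2 * c) * (k%:R + c) ^+ 2 * b k.+1 + A k.+1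
       <= k%:R * S k + rho0 / (2 * c) * k%:R ^+ 2 * b k + A k].
Proof.
move=> fp fc gp K0 fxs gxs gys r0 c1 g01 alg.
have oK := opnorm_gt0 K0.
have /andP[g0 g1] := g01.
have c0 : 0 < c by lra.
have kc k : 0 < k%:R + c :> R by rewrite ltr_wpDl.
have tauE k : tau c k = c / (k%:R + c).
  case: k => [|k] /=; first by rewrite add0r divff// gt_eqF.
  by rewrite -natr1 addrAC.
have tau0 k : 0 < tau c k by rewrite tauE divr_gt0.
have rhok k : 0 < rho rho0 c k by rewrite divr_gt0.
have betak k : 0 < beta K rho0 c gamma k.
  by rewrite divr_gt0// mulr_gt0// exprn_gt0.
have gcp : proper_fun (conjugate g).
  split=> [z|]; first exact: conjugate_proper.
  by exists ys; rewrite /dom /=; move: gys; rewrite fin_numE lt_neqAle leey andbT => /andP[].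
have gcc := conjugate_convex gp.
pose r k := if k is j.+1 then
  (rho rho0 c j)^-1 *: (ytilde j + rho rho0 c j *: (K *m xhat j) - y k) else K *m x0.
pose v k := (beta K rho0 c gamma k)^-1 *:
  (xhat k - beta K rho0 c gamma k *: (K^T *m y k.+1) - x k.+1).
have subf k : subgradient f (x k.+1) (v k) :=
  prox_subgradient (betak k) fp fc (pd_x alg k).
have subg k : subgradient (conjugate g) (y k.+1) (r k.+1) :=
  prox_subgradient (rhok k) gcp gcc (pd_y alg k).
pose Z k := (tau c k)^-1 *: (xhat k - (1 - tau c k) *: x k) - xs.
pose A k := c / 2 * (rho0 * opnorm K ^+ 2 / gamma * dot (Z k) (Z k)
  + ((1 - gamma) * rho0)^-1 * dot (ytilde k - ys) (ytilde k - ys)).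
have etag : 0 < (1 - gamma) * rho0 by rewrite mulr_gt0// subr_gt0.
exists r, A => S b; split.
- rewrite /A /Z /= subrr scale0r subr0 invr1 scale1r (pd_xhat0 alg) (pd_ytilde0 alg).
  by rewrite !enorm_sqr.
- move=> k; rewrite /A mulr_ge0 ?divr_ge0 ?(ltW c0)//.
  rewrite addr_ge0// mulr_ge0 ?dot_ge0 ?invr_ge0 ?(ltW etag)//.
  by rewrite divr_ge0 ?(ltW g0)// mulr_ge0 ?(ltW r0)// sqr_ge0.
- by move=> k; have [] := subf k.
- exact: subg.
move=> k.
have t0 := tau0 k; have tk := tauE k.
have rk0 := rhok k; have kc0 := kc k.
have t1E : 1 - tau c k = k%:R / (k%:R + c) by rewrite tk; field; rewrite gt_eqF.
have t1 : 0 <= 1 - tau c k by rewrite t1E divr_ge0// ltW.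
have ytE : ytilde k.+1 = ytilde k + ((1 - gamma) * rho rho0 c k) *:
    ((K *m x k.+1 - r k.+1) - (1 - tau c k) *: (K *m x k - r k)).
  rewrite (pd_ytilde alg) /Defs.eta.
  case: k {t0 tk rk0 kc0 t1E t1} => [|j].
    have rne := lt0r_neq0 (rhok 0).
    rewrite /= subrr mulr0 mul0r !scale0r !subr0 mulmxBr /r.
    by apply/colP => i; rewrite !mxE; field.
  have rne := lt0r_neq0 (rhok j.+1); have rne' := lt0r_neq0 (rhok j).
  have rr : tau c j * (1 - tau c j.+1) / tau c j.+1 * rho rho0 c j =
     rho rho0 c j.+1 * (1 - tau c j.+1).
    by rewrite /rho; field; rewrite !gt_eqF.
  have -> : tau c j.+1.-1 * (1 - tau c j.+1) / tau c j.+1 =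
    rho rho0 c j.+1 * (1 - tau c j.+1) / rho rho0 c j.
    by rewrite -rr /= mulfK.
  rewrite !mulmxBr -!scalemxAr mulmxBr /r /=.
  move: (c / (j%:R + c + 1)) => tt.
  by apply/colP => i; rewrite !mxE; field; rewrite rne rne'.
have step := @pd_one_step R p n K (rho rho0 c k) gamma (tau c k) (x k) (xhat k)
  (x k.+1) xs (r k) (r k.+1) (ytilde k) (y k.+1) ys
  (fine (f (x k))) (fine (f (x k.+1))) (fine (f xs))
  (dot (r k) (y k) - fine (conjugate g (y k)))
  (dot (r k.+1) (y k.+1) - fine (conjugate g (y k.+1))) (fine (g (K *m xs)))
  K0 rk0 g01 (ltW t0).
have [fk1 fsub] := subf k; have [gk1 gsub] := subg k.
move: step; rewrite -ytE => step.
(* xhat is extrapolated so that Z k.+1 does not involve tau c k.+1 *)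
have xi1 : x k.+1 - ((1 - tau c k) *: x k + tau c k *: xs) = tau c k *: Z k.+1.
  rewrite /Z (pd_xhat alg).
  have tn := lt0r_neq0 t0; have tn' := lt0r_neq0 (tau0 k.+1).
  by apply/colP => i; rewrite !mxE; field; rewrite tn tn'.
have xi0 : xhat k - ((1 - tau c k) *: x k + tau c k *: xs) = tau c k *: Z k.
  rewrite /Z; have tn := lt0r_neq0 t0.
  by apply/colP => i; rewrite !mxE; field.
have H1 : 0 <= (1 - tau c k) * (fine (f (x k)) - fine (f (x k.+1)) -
  dot (v k) (x k - x k.+1)).
  move: t1; case: (k) => [|j] t1j; first by rewrite /= subrr mul0r.
  have [fj1 _] := subf j; have [_ fs] := subf j.+1.
  by rewrite mulr_ge0//; have := fs (x j.+1); rewrite -(fineK fj1) lee_fin; lra.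
have H2 : 0 <= (1 - tau c k) * (dot (r k) (y k) - fine (conjugate g (y k)) -
   (dot (r k.+1) (y k.+1) - fine (conjugate g (y k.+1))) - dot (y k.+1) (r k - r k.+1)).
  move: t1; case: (k) => [|j] t1j; first by rewrite /= subrr mul0r.
  have [gj1 gs] := subg j; have [gj2 _] := subg j.+1.
  rewrite mulr_ge0//; have := gs (y j.+2); rewrite -(fineK gj2) lee_fin.
  by rewrite !dotDr !dotNr !(dotC (y j.+2)); lra.
have H3 : fine (f (x k.+1)) + dot (v k) (xs - x k.+1) <= fine (f xs).
  by rewrite -lee_fin (fineK fxs); exact: fsub.
have H4 : dot (r k.+1) (y k.+1) - fine (conjugate g (y k.+1))
    + dot (y k.+1) (K *m xs - r k.+1) <= fine (g (K *m xs)).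
  have := fenchel_young g (K *m xs) (y k.+1).
  rewrite -(fineK gxs) -(fineK gk1) -EFinB lee_fin dotDr dotNr !(dotC (y k.+1)) /=; lra.
have H5 : y k.+1 = ytilde k + rho rho0 c k *: (K *m xhat k - r k.+1).
  have rne := lt0r_neq0 rk0.
  by apply/colP => i; rewrite !mxE; field.
have {step H1 H2 H3 H4 H5} step := step H1 H2 H3 H4 H5.
rewrite xi1 xi0 !(dotZl (tau c k)) !(dotZr (tau c k)) in step.
have := ler_wpM2l (_ : 0 <= (k%:R + c) / 2) step.
rewrite divr_ge0 ?(ltW kc0)// => /(_ isT).
rewrite /S /b /A /split_lagrangian t1E.
have rhoE : rho rho0 c k = rho0 * (k%:R + c) / c.
  by rewrite /rho tk; field; rewrite !gt_eqF.
rewrite rhoE tk.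
clear - kc0 c0 r0 g0 g1 oK.
move: (dot (Z k) (Z k)) (dot (Z k.+1) (Z k.+1)) (dot (ytilde k - ys) (ytilde k - ys))
  (dot (ytilde k.+1 - ys) (ytilde k.+1 - ys)) => z z' d d'.
move: (dot (K *m x k - r k) (K *m x k - r k))
  (dot (K *m x k.+1 - r k.+1) (K *m x k.+1 - r k.+1)) => u u'.
move: (_ - (fine (f xs) + fine (g (K *m xs)))) => s'.
move: (_ - (fine (f xs) + fine (g (K *m xs)))) => s.
move: (opnorm K) oK => L L0.
have gn : 0 < 1 - gamma by rewrite subr_gt0.
by congr (_ <= _); field; rewrite ?gt_eqF.
Qed.

(** * Summability and lower limits *)

(** The series of 1 / (k ln k) diverges like ln ln: the increment of ln ln from
    [m] to [m + 1] is at most [1 / (m ln m)], by [ln (1 + z) <= z] used twice. *)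
Lemma lnln_le_sum_inv (R : realType) N :
  ln (ln (N%:R + 2)) - ln (ln 2) <= \sum_(2 <= k < N + 2) (k%:R * ln k%:R)^-1 :> R.
Proof.
elim: N => [|N IH].
  by rewrite add0n add0r subrr big_geq.
rewrite addSn big_nat_recr ?leq_addl//=.
have n1 : 1 < (N + 2)%:R :> R by rewrite ltr1n addnC.
have n0 : 0 < (N + 2)%:R :> R by rewrite (lt_trans _ n1).
have l0 : 0 < ln (N + 2)%:R :> R by rewrite ln_gt0.
have -> : N.+1%:R + 2 = (N + 2)%:R + 1 :> R by rewrite -addn1 !natrD; ring.
move: IH; rewrite -natrD; set m : R := (N + 2)%:R => IH.
suff : ln (ln (m + 1)) - ln (ln m) <= (m * ln m)^-1 by lra.
have m1 : 0 < m + 1 by lra.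
have lm1 : ln (m + 1) = ln m + ln (1 + m^-1).
  by rewrite -lnM ?posrE ?addr_gt0 ?invr_gt0// mulrDr mulr1 divff// gt_eqF.
have lm1_gt0 : 0 < ln (m + 1) by rewrite ln_gt0; lra.
rewrite -ln_div ?posrE//.
have -> : ln (m + 1) / ln m = 1 + ln (1 + m^-1) / ln m.
  by rewrite lm1 mulrDl divff// gt_eqF.
have mi : 0 < m^-1 by rewrite invr_gt0.
have lmi : 0 <= ln (1 + m^-1) by rewrite ln_ge0; lra.
apply: (le_trans (le_ln1Dx _)).
  by apply: lt_le_trans (divr_ge0 lmi (ltW l0)); rewrite ltrN10.
rewrite invfM ler_wpM2r ?invr_ge0 ?(ltW l0)//.
by apply: le_ln1Dx; lra.
Qed.

(** Otherwise [e k >= eps / (k ln k)] for all large [k], against the divergence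
    of that series. *)
Lemma summable_log_small (R : realType) (e : nat -> R) B :
  (forall k, 0 <= e k.+1) -> (forall N, \sum_(1 <= k < N) e k <= B) ->
  forall eps, 0 < eps -> forall N, exists2 k, (N <= k)%N & k%:R * ln k%:R * e k < eps.
Proof.
move=> e0 eB eps eps0 N; apply: contrapT => H.
have big k : (N <= k)%N -> eps <= k%:R * ln k%:R * e k.
  by move=> Nk; rewrite leNgt; apply/negP => ke; apply: H; exists k.
pose M := maxn N 2.
have ek k : (M <= k)%N -> (k%:R * ln k%:R)^-1 <= e k / eps.
  rewrite geq_max => /andP[Nk k2].
  have k1 : 1 < k%:R :> R by rewrite ltr1n.
  have kl : 0 < k%:R * ln k%:R :> R by rewrite mulr_gt0 ?ln_gt0// (lt_trans _ k1).
  rewrite ler_pdivlMr// ler_pdivrMl//; exact: big.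
have bnd n : \sum_(M <= k < n) (k%:R * ln k%:R)^-1 <= B / eps.
  apply: (@le_trans _ _ (\sum_(M <= k < n) e k / eps)).
    by apply: ler_sum_nat => k /andP[Mk _]; exact: ek.
  rewrite -mulr_suml ler_pM2r ?invr_gt0//.
  have [Mn|nM] := leqP M n; last first.
    by rewrite big_geq ?(ltnW nM)//; have := eB 0; rewrite big_geq.
  apply: le_trans (eB n); rewrite [leRHS](@big_cat_nat _ _ _ M 1 n)//=; last first.
    by rewrite (leq_trans _ (leq_maxr _ _)).
  by rewrite lerDr big_nat_cond; apply: sumr_ge0 => -[|k].
pose D := \sum_(2 <= k < M) (k%:R * ln k%:R)^-1 + B / eps + ln (ln 2) : R.
have all n : ln (ln (n%:R + 2)) <= D.
  have [Mn|nM] := leqP M (n + 2).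
    have := lnln_le_sum_inv R n.
    rewrite (@big_cat_nat _ _ _ M 2 (n + 2)) ?leq_maxr//=.
    by have := bnd (n + 2); rewrite /D; lra.
  have := lnln_le_sum_inv R M; rewrite (@big_cat_nat _ _ _ M 2 (M + 2)) ?leq_maxr ?leq_addr//=.
  have := bnd (M + 2).
  have : ln (ln (n%:R + 2)) <= ln (ln (M%:R + 2)) :> R.
    have l2 : 0 < ln 2%:R :> R by rewrite ln_gt0// ltr1n.
    have le2 (m : nat) : ln 2%:R <= ln (m%:R + 2) :> R.
      by rewrite ler_ln ?posrE ?lerDr// ltr_wpDl.
    rewrite ler_ln ?posrE; try exact: lt_le_trans l2 (le2 _).
    rewrite ler_ln ?posrE ?ltr_wpDl// lerD2r ler_nat.
    by apply: ltnW; apply: leq_ltn_trans nM; rewrite leq_addr.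
  by rewrite /D; lra.
pose n := Num.truncn (expR (expR (D + 1))).
have := all n.+1; apply/negP; rewrite -ltNge.
have nb : expR (expR (D + 1)) < n.+1%:R + 2 :> R.
  by apply: (lt_trans (truncnS_gt _)); rewrite ltrDl.
have np : 0 < n.+1%:R + 2 :> R by apply: lt_trans nb; exact: expR_gt0.
have : expR (D + 1) < ln (n.+1%:R + 2) by rewrite -ltr_expR lnK ?posrE.
move=> H1; have : D + 1 < ln (ln (n.+1%:R + 2)).
  by rewrite -ltr_expR lnK ?posrE//; apply: lt_trans H1; exact: expR_gt0.
lra.
Qed.

Lemma limn_einf_eq0 (R : realType) (u : nat -> \bar R) :
  (forall k, 0 <= u k)%E ->
  (forall eps, 0 < eps -> forall N, exists2 k, (N <= k)%N & (u k <= eps%:E)%E) ->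
  limn_einf u = 0%E.
Proof.
move=> u0 H; rewrite limn_einf_lim.
have -> : einfs u = cst 0%E; last exact: lim_cst.
apply/funext => N; apply/eqP; rewrite eq_le; apply/andP; split.
  apply/lee_addgt0Pr => eps eps0; rewrite add0e.
  have [k Nk ke] := H _ eps0 N.
  by apply: le_trans ke; apply: ereal_inf_lbound; exists k.
by apply: le_ereal_inf_tmp => _ [k _ <-].
Qed.

(** At an index where [k ln k (S k + k b k)] is below [h^2], both
    [k sqrt (ln k) S k] and [k sqrt (ln k) sqrt (b k)] are at most [h]: the first
    because [sqrt (ln k) <= ln k], the second because its square is
    [k ln k (k b k)]. *)
Lemma summable_sqrt_log_small (R : realType) (S b : nat -> R) B C :
  (forall k, 0 <= S k.+1) -> (forall k, 0 <= b k) -> 0 <= C ->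
  (forall N, \sum_(1 <= k < N) (S k + k%:R * b k) <= B) ->
  forall eps, 0 < eps -> forall N, exists2 k, (N <= k)%N &
    k%:R * Num.sqrt (ln k%:R) * (S k + C * Num.sqrt (b k)) <= eps.
Proof.
move=> S0 b0 C0 SB eps eps0 N.
pose h := Order.min 1 (eps / (1 + C)).
have C1 : 0 < 1 + C by lra.
have h0 : 0 < h by rewrite lt_min ltr01 divr_gt0.
have h1 : h <= 1 by rewrite ge_min lexx.
have hC : (1 + C) * h <= eps by rewrite -ler_pdivlMl// mulrC ge_min lexx orbT.
have e0 k : 0 <= S k.+1 + k.+1%:R * b k.+1 by rewrite addr_ge0// mulr_ge0.
have [k] := summable_log_small e0 SB (exprn_gt0 2 h0) (maxn N (Num.truncn (expR 1 : R)).+1).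
rewrite geq_max => /andP[Nk ek] small; exists k => //.
have k0 : 0 < k%:R :> R by rewrite ltr0n (leq_trans _ ek).
have lk : 1 <= ln k%:R :> R.
  rewrite -ler_expR lnK ?posrE// ltW//.
  by apply: lt_le_trans (truncnS_gt _) _; rewrite ler_nat.
have Sk : 0 <= S k by case: (k) ek => // j _.
have l0 : 0 <= ln k%:R :> R by lra.
have sl : Num.sqrt (ln k%:R) <= ln k%:R :> R.
  rewrite -(@ler_pXn2r _ 2) ?nnegrE ?sqrtr_ge0// sqr_sqrtr// expr2.
  by rewrite -[leLHS]mulr1 ler_pM2l// (lt_le_trans ltr01).
have X0 : 0 <= k%:R * ln k%:R * S k :> R by rewrite !mulr_ge0// ltW.
have Y0 : 0 <= k%:R * ln k%:R * (k%:R * b k) :> R by rewrite !mulr_ge0// ltW.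
rewrite mulrDr in small.
have H1 : k%:R * Num.sqrt (ln k%:R) * S k <= h.
  apply: (@le_trans _ _ (k%:R * ln k%:R * S k)).
    by rewrite ler_wpM2r// ler_pM2l.
  by apply: (@le_trans _ _ (h ^+ 2)); [lra|nra].
have H2 : k%:R * Num.sqrt (ln k%:R) * Num.sqrt (b k) <= h.
  rewrite -(@ler_pXn2r _ 2) ?nnegrE ?mulr_ge0 ?sqrtr_ge0 ?(ltW h0) ?(ltW k0)//.
  rewrite !exprMn !sqr_sqrtr//.
  have -> : k%:R ^+ 2 * ln k%:R * b k = k%:R * ln k%:R * (k%:R * b k) by ring.
  lra.
apply: le_trans hC; rewrite mulrDr mulrCA mulrDl mul1r lerD//.
by rewrite ler_wpM2l.
Qed.

(** * Convergence rates *)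

Local Open Scope ereal_scope.

Lemma le_ediv_pos (R : realType) (a Q : \bar R) (d : R) :
  (0 < d)%R -> a * d%:E <= Q -> a <= Q / d%:E.
Proof. by move=> d0 aQ; rewrite inver gt_eqF// lee_pdivlMr. Qed.

Lemma le_add_sqrte (R : realType) (a C : R) (Q : \bar R) :
  (0 <= a)%R -> (0 <= C)%R -> a%:E <= Q ->
  (a + C * Num.sqrt a)%:E <= Q + C%:E * sqrte Q.
Proof.
move=> a0 C0 aQ; rewrite EFinD EFinM; apply: leeD => //.
apply: lee_wpmul2l; first by rewrite lee_fin.
have Q0 : 0 <= Q by apply: le_trans aQ; rewrite lee_fin.
by rewrite -[(Num.sqrt a)%:E]/(sqrte a%:E) lee_sqrt.
Qed.

Theorem theorem3p5 (R : realType) (p n : nat)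
    (f : 'cV[R]_p -> \bar R) (g : 'cV[R]_n -> \bar R) (K : 'M[R]_(n, p))
    (f_pcc : proper_closed_convex f) (g_pcc : proper_closed_convex g)
    (K_neq0 : K != 0%R)
    (sol_ne : argmin (primal f g K) !=set0)
    (qualif : rel_interior (dom_diff f g K) 0%R)
    (xs : 'cV[R]_p) (xs_opt : argmin (primal f g K) xs)
    (ys : 'cV[R]_n) (ys_opt : argmin (dual f g K) ys)
    (rho0 c gamma : R) (rho0_gt0 : (0 < rho0)%R) (c_gt1 : (1 < c)%R)
    (gamma_in : (0 < gamma < 1)%R)
    (x0 : 'cV[R]_p) (y0 : 'cV[R]_n)
    (x xhat : nat -> 'cV[R]_p) (y ytilde ybar : nat -> 'cV[R]_n)
    (alg : pd_iterates f g K rho0 c gamma x0 y0 x xhat y ytilde ybar) :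
  let Fs := primal_val f g K in
  let R0sq := R0sq f g K rho0 c gamma x0 xs y0 ys in
  let R1sq := R1sq f g K rho0 c gamma x0 xs y0 ys in
  [/\ forall k : nat,
        0 <= lagrangian f g K (x k) ys - Fs <= R0sq / (k%:R + c - 1)%:E,
      limn_einf (fun k : nat => (k%:R * ln k%:R)%:E
                   * (lagrangian f g K (x k) ys - Fs)) = 0
    & forall Mg : R, (0 <= Mg)%R -> lipschitz_on_dom Mg g ->
        (* Kx^k in dom g: without it F(x^k) may be +oo for every k >= 1 while
           R1sq Mg is finite, e.g. when g is the indicator of a point *)
        (forall k : nat, dom g (K *m x k.+1)%R) ->
        (forall k : nat,
           0 <= primal f g K (x k) - Fs <= R1sq Mg / (k%:R + c - 1)%:E)
        /\ limn_einf (fun k : nat => (k%:R * Num.sqrt (ln k%:R))%:E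
                        * (primal f g K (x k) - Fs)) = 0].
Proof.
move=> Fs R0 R1.
have [fp fcl fc] := f_pcc; have [gp gcl gc] := g_pcc.
have [fxs gxs] := primal_opt_fin_num fp gp qualif xs_opt.
have [gys saddle] := dual_opt_saddle fp fc gp gc qualif xs_opt ys_opt.
have [r [A [A0E A0 fx gr desc]]] :=
  pd_descent fp fc gp K_neq0 fxs gxs gys rho0_gt0 c_gt1 gamma_in alg.
pose F := (fine (f xs) + fine (g (K *m xs)))%R.
have FE : Fs = F%:E.
  by rewrite /Fs (primal_val_argmin xs_opt) /primal -(fineK fxs) -(fineK gxs).
rewrite -/F in desc.
set S := fun k => (split_lagrangian f g K (x k) (r k) (y k) ys - F)%R in desc.
set b := fun k => dot (K *m x k - r k) (K *m x k - r k) in desc.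
have Flag z : F%:E <= lagrangian f g K z ys.
  by have := saddle z; rewrite -(primal_val_argmin xs_opt) -/Fs FE.
have Fpri z : F%:E <= primal f g K z by rewrite -FE; apply: ereal_inf_lbound; exists z.
pose l k := (fine (f (x k)) + dot (K *m x k) ys - fine (conjugate g ys))%R.
have lE k : lagrangian f g K (x k.+1) ys = (l k.+1)%:E.
  by rewrite /lagrangian -(fineK (fx k)) -(fineK gys).
have lS k : (l k.+1 - F <= S k.+1)%R.
  have [_ /(_ ys)] := gr k; rewrite -{1}(fineK gys) lee_fin /S /split_lagrangian /l.
  by rewrite !dotDr !dotNr !(dotC ys); lra.
have lF k : (0 <= l k.+1 - F)%R.
  by rewrite subr_ge0 -lee_fin -lE.
have S0 k : (0 <= S k.+1)%R by exact: le_trans (lF k) (lS k).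
have b0 k : (0 <= b k)%R by exact: dot_ge0.
have [rS rb [B sumB]] := descent_rates c_gt1 rho0_gt0 S0 b0 A0 desc.
have c1 : (0 < c - 1)%R by lra.
have gap0 : 0 <= (c - 1)%:E * (primal f g K x0 - Fs).
  by rewrite mule_ge0 ?lee_fin ?(ltW c1)// FE sube_ge0.
have R0E : R0 = (c - 1)%:E * (primal f g K x0 - Fs) + (A 0%N)%:E.
  by rewrite /R0 /R0sq A0E.
have R0A : (A 0%N)%:E <= R0 by rewrite R0E leeDr.
have R0g : (primal f g K x0 - Fs) * (c - 1)%:E <= R0.
  by rewrite R0E muleC leeDl// lee_fin.
have kc k : (0 < k%:R + c :> R)%R by rewrite ltr_wpDl//; lra.
have kE k : (k.+1%:R + c - 1 = k%:R + c :> R)%R by rewrite -natr1; ring.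
split.
- case=> [|k]; apply/andP; split; rewrite ?FE ?sube_ge0//.
  + apply: le_ediv_pos; rewrite add0r//; apply: le_trans R0g.
    rewrite lee_wpmul2r ?lee_fin ?(ltW c1)// FE leeB// (pd_x0 alg).
    rewrite /lagrangian /primal -addeA; apply: leeD => //.
    have := fenchel_young g (K *m x0)%R ys; rewrite -(fineK gys).
    case: (g _) (gp.1 (K *m x0)%R) => [a||//] _; last by rewrite leey.
    by rewrite -!EFinB !lee_fin; lra.
  + rewrite kE; apply: le_ediv_pos => //; apply: le_trans R0A.
    rewrite lE -EFinB -EFinM lee_fin mulrC; apply: le_trans (rS k).
    by rewrite ler_pM2l.
- apply: limn_einf_eq0 => [k|eps eps0 N].
    rewrite mule_ge0 ?FE ?sube_ge0// lee_fin.
    by case: k => [|k]; rewrite ?mul0r// mulr_ge0// ln_ge0// ler1n.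
  have e0 k : (0 <= S k.+1 + k.+1%:R * b k.+1)%R by rewrite addr_ge0// mulr_ge0.
  have [[//|k]] := summable_log_small e0 sumB eps0 N.+1.
  move=> Nk /ltW small; exists k.+1; first exact: ltnW.
  rewrite lE FE -EFinB -EFinM lee_fin; apply: le_trans small.
  rewrite ler_wpM2l// ?mulr_ge0 ?ln_ge0 ?ler1n//.
  by apply: le_trans (lS k) _; rewrite lerDl mulr_ge0.
move=> Mg Mg0 lip domg.
pose C := (enorm ys + Mg)%R.
have C0 : (0 <= C)%R by rewrite addr_ge0// enorm_ge0.
have gKx k : g (K *m x k.+1) \is a fin_num.
  by rewrite fin_numE gp.1 lt_eqF//; exact: domg.
have pE k : primal f g K (x k.+1) = (fine (f (x k.+1)) + fine (g (K *m x k.+1)))%:E.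
  by rewrite /primal -(fineK (fx k)) -(fineK (gKx k)).
have pS k : (fine (f (x k.+1)) + fine (g (K *m x k.+1)) - F <=
    S k.+1 + C * Num.sqrt (b k.+1))%R.
  have grE := fenchel_equality_of_conjugate g_pcc (gr k).
  have := lip (K *m x k.+1) (r k.+1) (domg k).
  rewrite /dom /= grE ltry => /(_ isT).
  rewrite -(fineK (gKx k)) -EFinB abse_EFin lee_fin -[enorm _]/(Num.sqrt (b k.+1)).
  have := cauchy_schwarz ys (K *m x k.+1 - r k.+1).
  rewrite -[enorm (_ - _)]/(Num.sqrt (b k.+1)) !ler_norml.
  move=> /andP[cs _] /andP[_ gl].
  by rewrite /S /split_lagrangian /C mulrDl; lra.
have sC0 : (0 <= Num.sqrt (2 * c / rho0) * C)%R by rewrite mulr_ge0// sqrtr_ge0.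
have R1A : (A 0%N + Num.sqrt (2 * c / rho0) * C * Num.sqrt (A 0%N))%:E <= R1 Mg.
  exact: le_add_sqrte.
have R01 : R0 <= R1 Mg.
  by rewrite leeDl// mule_ge0 ?lee_fin// sqrte_ge0.
have c_gt0 : (0 < c)%R by lra.
split.
- case=> [|k]; apply/andP; split; rewrite ?FE ?sube_ge0//.
  + apply: le_ediv_pos; rewrite add0r//; apply: le_trans R01.
    by rewrite (pd_x0 alg) -FE.
  + rewrite kE; apply: le_ediv_pos => //; apply: le_trans R1A.
    rewrite pE -EFinB -EFinM lee_fin mulrC.
    apply: (@le_trans _ _ ((k%:R + c) * (S k.+1 + C * Num.sqrt (b k.+1)))%R).
      by rewrite ler_pM2l.
    rewrite mulrDr lerD// mulrCA [leRHS]mulrAC [leRHS]mulrC ler_wpM2l//.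
    rewrite -sqrtrM; last by rewrite divr_ge0 ?mulr_ge0// ltW.
    rewrite -(@ler_pXn2r _ 2) ?nnegrE ?mulr_ge0 ?sqrtr_ge0 ?(ltW (kc k))//.
    rewrite exprMn !sqr_sqrtr//; last first.
      by rewrite mulr_ge0// divr_ge0 ?mulr_ge0// ltW.
    rewrite -ler_pdivrMl ?divr_gt0 ?mulr_gt0// invf_div mulrA.
    exact: rb.
- apply: limn_einf_eq0 => [k|eps eps0 N].
    apply: mule_ge0; last by rewrite FE sube_ge0.
    by rewrite lee_fin mulr_ge0// sqrtr_ge0.
  have [[//|k]] := summable_sqrt_log_small S0 b0 C0 sumB eps0 N.+1.
  move=> Nk small; exists k.+1; first exact: ltnW.
  rewrite pE FE -EFinB -EFinM lee_fin; apply: le_trans small.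
  by rewrite ler_wpM2l// mulr_ge0// sqrtr_ge0.
Qed.
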